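(* For any $n \geq 3$, any configuration of size $\binom{n-1}{2}+2$ contains either a $4$-cap, an $n$-cup, or a $(3, n-1)$-gon.
   Context: A configuration is a finite set $S$ of points with a linear order $<$ and, for every $3$-element subset of $S$, an arbitrary assignment declaring it either a cap or a cup. A set of points $x_1 < x_2 < \cdots < x_a$ of $S$ forms an $a$-cup (resp. $a$-cap) if for every $1 < i < a$ the triple $\{x_{i-1}, x_i, x_{i+1}\}$ is assigned cup (resp. cap); in particular any single point is a $1$-cup and $1$-cap and any two points form a $2$-cup and a $2$-cap. Its endpoints are $x_1$ and $x_a$. A (weak) $(a,b)$-gon is a pair consisting of an $a$-cap and a $b$-cup which have the same two endpoints (the cap and cup are allowed to share other vertices). *)

(* Defs.v *)
From mathcomp Require Import all_boot.
Set Implicit Arguments. Unset Strict Implicit. Unset Printing Implicit Defensive.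

(* A configuration of size N: points 'I_N ordered by their natural order, and
   an assignment f i j k for each triple i < j < k (true = cup, false = cap).
   Values of f on non-increasing triples are irrelevant. *)
Definition config (N : nat) := 'I_N -> 'I_N -> 'I_N -> bool.

Fixpoint consec3 (T : Type) (P : T -> T -> T -> bool) (s : seq T) : bool :=
  match s with
  | x :: ((y :: z :: _) as t) => P x y z && consec3 P t
  | _ => true
  end.

Definition is_cup N (f : config N) (s : seq 'I_N) : bool :=
  sorted (fun x y : 'I_N => x < y) s && consec3 f s.
Definition is_cap N (f : config N) (s : seq 'I_N) : bool :=
  sorted (fun x y : 'I_N => x < y) s && consec3 (fun x y z => ~~ f x y z) s.

Definition has_cup N (f : config N) (a : nat) : Prop :=
  exists s : seq 'I_N, is_cup f s /\ size s = a.
Definition has_cap N (f : config N) (a : nat) : Prop :=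
  exists s : seq 'I_N, is_cap f s /\ size s = a.

Definition has_gon N (f : config N) (a b : nat) : Prop :=
  exists c u : seq 'I_N,
    [/\ is_cap f c, is_cup f u, size c = a & size u = b] /\
    ohead c = ohead u /\ ohead (rev c) = ohead (rev u).

(* Main.v *)
(* Put m = n - 1 and suppose there is no 4-cap and no (m+1)-cup. Call an m-cup
   from x to z laced when some i-cup ends at x, some j-cup starts at z and
   m <= i + j. The key claim, by induction on m, is that among C(m,2) + 2 points
   either some o is both the end and the start of m-cups ("hinged"), or there are
   laced m-cups x -> z and x' -> z' with x < x' < z < z' ("interweaved").

   Let rank v be the size of the longest cup ending at v. Delete the fewer than
   m records of rank below m: any other point w of rank below m is preceded by a
   u of at least its rank, and the edge uw then extends every cup starting at w,
   so laced (m-1)-cups of the remaining points lengthen to laced m-cups. This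
   fails only at a point o that ends an m-cup and starts an (m-1)-cup; in that
   case the mirror image yields o' starting an m-cup and ending an (m-1)-cup, and
   o', o complete an interweaved pair directly.

   Without a 4-cap, an edge cannot be both the last edge of a cap and the first
   edge of another. If there is no (3, m)-gon either, then applying this to the
   edge x'z of an interweaved pair (or at the hinge o, together with a laced
   m-cup avoiding o) joins the lacing cups into an (m+1)-cup. *)
Require Import Defs.
From mathcomp Require Import all_boot.
From mathcomp Require Import zify.
From Stdlib Require Import Classical.

Set Implicit Arguments.
Unset Strict Implicit.
Unset Printing Implicit Defensive.

(** * Gluing and reversing lists of consecutive triples *)

Lemma consec3_glue (T : Type) (f : T -> T -> T -> bool) p a b q :
  consec3 f (p ++ a :: b :: q) =
  consec3 f (p ++ [:: a; b]) && consec3 f (a :: b :: q).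
Proof.
elim: p => [//|x [|y p] IH]; first by rewrite /= !andbT.
have -> : (x :: y :: p) ++ a :: b :: q = x :: ((y :: p) ++ a :: b :: q) by [].
have -> : (x :: y :: p) ++ [:: a; b] = x :: ((y :: p) ++ [:: a; b]) by [].
by move: IH; case: p => [|z p] /= ->; rewrite andbA.
Qed.

Lemma consec3_rev (T : Type) (f : T -> T -> T -> bool) s :
  consec3 (fun x y z => f z y x) (rev s) = consec3 f s.
Proof.
elim: s => [//|x [|y [|z t]] IH] //.
rewrite !rev_cons -!cats1 -!catA [LHS]consec3_glue /= andbT.
by move: IH; rewrite !rev_cons -!cats1 -!catA /= => ->; rewrite andbC.
Qed.

(** The order is an arbitrary relation, so that its reversal is another instance. *)
Definition no_4cap (T : eqType) (lt : rel T) (f : T -> T -> T -> bool) :=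
  [/\ irreflexive lt, transitive lt, forall x y, x != y -> lt x y || lt y x
    & forall a b c d, lt a b -> lt b c -> lt c d -> f a b c || f b c d].

(** * Cups and their end points *)

Section Cups.
Variables (T : finType) (lt : rel T) (f : T -> T -> T -> bool).
Implicit Types (S : {set T}) (s p q : seq T).

Definition cup S s := [&& sorted lt s, consec3 f s & all [in S] s].

Definition cup_to S k v := exists2 p, cup S (rcons p v) & (size p).+1 = k.
Definition cup_from S k v := exists2 q, cup S (v :: q) & (size q).+1 = k.
Definition cup_between S k x z :=
  exists q, [/\ cup S (x :: q), last x q = z & (size q).+1 = k].

Definition laced S m x z := cup_between S m x z /\
  exists i j, [/\ cup_to S i x, cup_from S j z & m <= i + j].

Definition interweaved S m := exists x x' z z',
  [/\ lt x x', lt x' z, lt z z', laced S m x z & laced S m x' z'].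

Definition hinged S m := exists o, cup_to S m o /\ cup_from S m o.

Definition cups_bounded S m := forall s, cup S s -> size s <= m.

(** Such an edge extends every cup ending at [b]; under the mirror condition that follows it extends
    every cup starting at [c]. *)
Definition never_cap_end S b c := forall a, a \in S -> lt a b -> f a b c.
Definition never_cap_start S b c := forall d, d \in S -> lt c d -> f b c d.

(* The size of the longest cup ending at [v]; for [k = 0] the empty tuple
   satisfies the condition because [last v [::] = v]. *)
Definition rank S v :=
  \max_(k < #|T|.+1 | [exists t : k.-tuple T, cup S t && (last v t == v)]) k.

(** The strict left-to-right maxima of the rank that lie below [m]. *)
Definition records S m :=
  [set d in S | (rank S d < m) &&
     [forall v in S, lt v d ==> (rank S v < rank S d)]].

Lemma cup1 S x : cup S [:: x] = (x \in S).
Proof. by rewrite /cup /= andbT. Qed.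

Lemma cup2 S x y : cup S [:: x; y] = [&& lt x y, x \in S & y \in S].
Proof. by rewrite /cup /= !andbT. Qed.

Lemma cup3 S x y z :
  cup S [:: x; y; z] = [&& lt x y, lt y z, f x y z, x \in S, y \in S & z \in S].
Proof. by rewrite /cup /= !andbT -!andbA. Qed.

Lemma cup_glue S p a b q :
  cup S (p ++ a :: b :: q) = cup S (p ++ [:: a; b]) && cup S (a :: b :: q).
Proof.
rewrite /cup consec3_glue.
have -> : sorted lt (p ++ a :: b :: q)
          = sorted lt (p ++ [:: a; b]) && sorted lt (a :: b :: q).
  case: p => [|x p] /=; first by rewrite andbT; case: (lt a b).
  rewrite !cat_path /= andbT.
  by case: (path lt x p); case: (lt (last x p) a); case: (lt a b).
have -> : all [in S] (p ++ a :: b :: q)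
          = all [in S] (p ++ [:: a; b]) && all [in S] (a :: b :: q).
  rewrite !all_cat /= andbT.
  by case: (all _ p); case: (a \in S); case: (b \in S).
by rewrite -!andbA; do !bool_congr.
Qed.

Lemma cup_catl S p q : cup S (p ++ q) -> cup S p.
Proof.
elim/last_ind: q => [|q x IH]; rewrite ?cats0 // -rcons_cat => h; apply: IH.
move: h; case/lastP: (p ++ q) => [//|r y]; case/lastP: r => [|r z].
  by rewrite cup2 cup1 => /and3P[].
by rewrite -!cats1 -!catA /= (cup_glue _ r z y [:: x]) => /andP[].
Qed.

Lemma cup_catr S p q : cup S (p ++ q) -> cup S q.
Proof.
elim: p => [//|x p IH] /= h; apply: IH; move: h.
case: (p ++ q) => [//|y [|z t]]; first by rewrite cup2 cup1 => /and3P[].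
rewrite /cup /= => /and3P[/andP[_ ->] h /andP[_ ->]]; rewrite andbT /=.
by case: t h => [//|w t] /andP[].
Qed.

Lemma cup_in S s v : cup S s -> v \in s -> v \in S.
Proof. by move=> /and3P[_ _ /allP h] /h. Qed.

Lemma cup_sub S S' s : S' \subset S -> cup S' s -> cup S s.
Proof.
move=> /subsetP sub /and3P[h1 h2 h3]; rewrite /cup h1 h2 /=.
by apply: sub_all h3 => x /sub.
Qed.

Lemma cup_append S p b c :
  cup S (rcons p b) -> c \in S -> lt b c -> never_cap_end S b c ->
  cup S (rcons (rcons p b) c).
Proof.
case/lastP: p => [|p a]; first by rewrite cup1 cup2 => -> -> ->.
rewrite -!cats1 -!catA /= => h cS bc hR; rewrite cup_glue h cup3 cS bc /=.
move/cup_catr: h; rewrite cup2 => /and3P[ab aS ->].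
by rewrite ab aS hR.
Qed.

Lemma cup_prepend S b c q :
  cup S (c :: q) -> b \in S -> lt b c -> never_cap_start S b c ->
  cup S (b :: c :: q).
Proof.
case: q => [|d q]; first by rewrite cup1 cup2 => -> -> ->.
move=> h bS bc hL; rewrite (cup_glue S [:: b] c d q) h cup3 bS bc andbT.
have := @cup_catl S [:: c; d] q h; rewrite cup2 => /and3P[cd -> dS].
by rewrite cd dS hL.
Qed.

Lemma cup_to_in S k v : cup_to S k v -> v \in S.
Proof. by case=> p /cup_in h _; apply: h; rewrite mem_rcons mem_head. Qed.

Lemma cup_from_in S k v : cup_from S k v -> v \in S.
Proof. by case=> p /cup_in h _; apply: h; rewrite mem_head. Qed.

Lemma cup_to_leq S i j v : cup_to S i v -> 0 < j <= i -> cup_to S j v.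
Proof.
case=> p hp <- /andP[j0 ji]; exists (drop ((size p).+1 - j) p).
  by apply: (@cup_catr S (take ((size p).+1 - j) p)); rewrite -rcons_cat cat_take_drop.
by rewrite size_drop; lia.
Qed.

Lemma cup_to_sub S S' k v : S' \subset S -> cup_to S' k v -> cup_to S k v.
Proof. by move=> sub [p /(cup_sub sub) hp hk]; exists p. Qed.

Lemma cup_from_sub S S' k v : S' \subset S -> cup_from S' k v -> cup_from S k v.
Proof. by move=> sub [p /(cup_sub sub) hp hk]; exists p. Qed.

Lemma cup_between_from S k x z : cup_between S k x z -> cup_from S k x.
Proof. by case=> q [hq _ <-]; exists q. Qed.

Lemma cup_between_to S k x z : cup_between S k x z -> cup_to S k z.
Proof.
case=> q [hq <- <-]; exists (belast x q); first by rewrite -lastI.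
by rewrite size_belast.
Qed.

Lemma cup_from_between S k x : cup_from S k x -> exists z, cup_between S k x z.
Proof. by case=> q hq <-; exists (last x q), q. Qed.

Lemma cup_to_between S k z : cup_to S k z -> exists x, cup_between S k x z.
Proof.
case=> [[|x p]] hp <-; first by exists z, [::].
by exists x, (rcons p z); rewrite last_rcons size_rcons.
Qed.

Lemma cup_from1 S v : v \in S -> cup_from S 1 v.
Proof. by exists [::]; rewrite ?cup1. Qed.

Lemma cup_to1 S v : v \in S -> cup_to S 1 v.
Proof. by exists [::]; rewrite ?cup1. Qed.

(** * Consequences of the absence of 4-caps *)

Hypothesis cap4 : no_4cap lt f.

Let irr : irreflexive lt. Proof. by case: cap4. Qed.
Let tr : transitive lt. Proof. by case: cap4. Qed.

Lemma cup_uniq S s : cup S s -> uniq s.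
Proof. by move=> /and3P[/(sorted_uniq tr irr)]. Qed.

(** A cap ending with the edge and a cap beginning with it would form a 4-cap. *)
Lemma never_cap_dichotomy S b c :
  lt b c -> never_cap_end S b c \/ never_cap_start S b c.
Proof.
move=> bc; case: (boolP [forall a in S, lt a b ==> f a b c]) => [/forall_inP h|].
  by left=> a aS ab; move: (h a aS); rewrite ab.
case/forall_inPn => a aS; rewrite negb_imply => /andP[ab /negPf nf].
right=> d dS cd; case: cap4 => _ _ _ h.
by have := h a b c d ab bc cd; rewrite nf.
Qed.

(** The case [k = 0] is separate because [cup_to] counts the end point, so its size is never 0. *)
Lemma leq_rankP S k v : reflect (k = 0 \/ cup_to S k v) (k <= rank S v).
Proof.
apply: (iffP idP) => [|[-> //|]].
  have : rank S v = 0 \/ cup_to S (rank S v) v.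
    rewrite /rank; apply: (big_ind (fun k => k = 0 \/ cup_to S k v)); first by left.
      by move=> i j hi hj; rewrite /maxn; case: ifP.
    move=> [i _] /= /existsP[t /andP[ct /eqP lt_]]; have := size_tuple t.
    case/lastP: (tval t) ct lt_ => [|p y] cp; first by left.
    by rewrite last_rcons size_rcons => yv hs; right; exists p; rewrite -?yv.
  case: k => [|k]; [by left|case=> [->|h] // hk; right].
  exact: cup_to_leq h _.
case=> p hp hk; have hs : size (rcons p v) == k by rewrite size_rcons hk.
have kT : k < #|T|.+1.
  by rewrite ltnS -(eqP hs) -(card_uniqP (cup_uniq hp)) max_card.
apply: (@leq_bigmax_cond _ _ _ (Ordinal kT)) => /=.
by apply/existsP; exists (Tuple hs); rewrite hp last_rcons eqxx.
Qed.

Lemma cup_to_rank S k v : cup_to S k v -> k <= rank S v.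
Proof. by move=> h; apply/leq_rankP; right. Qed.

Lemma rank_cup_to S k v : 0 < k -> k <= rank S v -> cup_to S k v.
Proof. by move=> k0 /leq_rankP[] // k_0; rewrite k_0 in k0. Qed.

Lemma rank_gt0 S v : v \in S -> 0 < rank S v.
Proof. by move=> /cup_to1 /cup_to_rank. Qed.

Lemma cup_to_append S k b c : cup_to S k b -> c \in S -> lt b c ->
  never_cap_end S b c -> cup_to S k.+1 c.
Proof.
case=> p hp <- cS bc hR; exists (rcons p b); first exact: cup_append.
by rewrite size_rcons.
Qed.

Lemma cup_from_prepend S k b c : cup_from S k c -> b \in S -> lt b c ->
  never_cap_start S b c -> cup_from S k.+1 b.
Proof. by case=> q hq <- bS bc hL; exists (c :: q); rewrite ?cup_prepend. Qed.

Lemma cup_between_prepend S k b c z : cup_between S k c z -> b \in S -> lt b c ->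
  never_cap_start S b c -> cup_between S k.+1 b z.
Proof. by case=> q [hq <- <-] bS bc hL; exists (c :: q); split=> //; apply: cup_prepend. Qed.

(** Otherwise a longest cup ending at [u] would continue to [v], which would then have the larger
    rank. *)
Lemma rank_le_never_cap_start S u v : u \in S -> v \in S -> lt u v ->
  rank S v <= rank S u -> never_cap_start S u v.
Proof.
move=> uS vS uv hr; case: (never_cap_dichotomy S uv) => // hR.
have := cup_to_append (rank_cup_to (rank_gt0 uS) (leqnn _)) vS uv hR.
by move=> /cup_to_rank; lia.
Qed.

(** * Cups of bounded size *)

Section Bounded.
Variables (S : {set T}) (m : nat).
Hypothesis bd : cups_bounded S m.

Lemma cup_to_bounded k v : cup_to S k v -> k <= m.
Proof. by case=> p /bd; rewrite size_rcons => h <-. Qed.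

Lemma cup_from_bounded k v : cup_from S k v -> k <= m.
Proof. by case=> p /bd h <-. Qed.

(** If the edge ended no cap, it would extend the [m]-cup ending at [z] beyond the bound. *)
Lemma end_never_cap_start z y : cup_to S m z -> y \in S -> lt z y ->
  never_cap_start S z y.
Proof.
move=> hz yS zy; case: (never_cap_dichotomy S zy) => // hR.
by have := cup_to_bounded (cup_to_append hz yS zy hR); lia.
Qed.

Lemma start_never_cap_end x y : cup_from S m x -> y \in S -> lt y x ->
  never_cap_end S y x.
Proof.
move=> hx yS yx; case: (never_cap_dichotomy S yx) => // hL.
by have := cup_from_bounded (cup_from_prepend hx yS yx hL); lia.
Qed.

Lemma end_not_before_start a b : cup_to S m a -> cup_from S m b -> ~~ lt a b.
Proof.
move=> ha hb; apply/negP => ab; have aS := cup_to_in ha.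
have hL := end_never_cap_start ha (cup_from_in hb) ab.
by have := cup_from_bounded (cup_from_prepend hb aS ab hL); lia.
Qed.

(** The two edges extend both cups to [o], and the cup [a], [o], [b] glues them into a single cup of
    [i + j + 1] points. *)
Lemma cup_join_bounded i j a o b : cup_to S i a -> o \in S -> cup_from S j b ->
  lt a o -> lt o b -> never_cap_end S a o -> f a o b -> never_cap_start S o b ->
  i + j < m.
Proof.
case=> p hp <- oS [q hq <-] ao ob hR faob hL.
have hp' := cup_append hp oS ao hR; have hq' := cup_prepend hq oS ob hL.
have : cup S (p ++ a :: o :: b :: q).
  have -> : cup S (p ++ a :: o :: b :: q)
            = cup S (rcons (rcons p a) o) && cup S [:: a; o; b].
    by rewrite cup_glue (cup_glue _ [:: a]) hq' andbT -!cats1 -catA.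
  have aS : a \in S by apply: (cup_in hp); rewrite mem_rcons mem_head.
  have bS : b \in S by apply: (cup_in hq); rewrite mem_head.
  by rewrite hp' cup3 ao ob faob aS oS bS.
by move/bd; rewrite size_cat /= !addnS addSn.
Qed.

End Bounded.

End Cups.

(** * Reversal of the order *)

Section Mirror.
Variables (T : finType) (lt : rel T) (f : T -> T -> T -> bool).
Implicit Types (S : {set T}).
Let lt' : rel T := fun x y => lt y x.
Let f' x y z := f z y x.

Lemma no_4cap_mirror : no_4cap lt f -> no_4cap lt' f'.
Proof.
case=> h1 h2 h3 h4; split.
- by move=> x; apply: h1.
- by move=> y x z yx zy; apply: h2 zy yx.
- by move=> x y /h3; rewrite orbC.
- by move=> a b c d ab bc cd; rewrite orbC; apply: h4.
Qed.

Lemma cup_mirror S s : cup lt' f' S (rev s) = cup lt f S s.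
Proof. by rewrite /cup rev_sorted consec3_rev all_rev. Qed.

Lemma cup_to_mirror S k v : cup_to lt f S k v -> cup_from lt' f' S k v.
Proof.
case=> p hp <-; exists (rev p); last by rewrite size_rev.
by rewrite -rev_rcons cup_mirror.
Qed.

Lemma cup_from_mirror S k v : cup_from lt f S k v -> cup_to lt' f' S k v.
Proof.
case=> p hp <-; exists (rev p); last by rewrite size_rev.
by rewrite -rev_cons cup_mirror.
Qed.

Lemma cup_between_mirror S k x z :
  cup_between lt f S k x z -> cup_between lt' f' S k z x.
Proof.
case=> q [hq hl <-]; exists (rev (belast x q)); split.
- by rewrite -hl -rev_rcons -lastI cup_mirror.
- by case: q {hq} hl => [<- //|y q] _; rewrite /= rev_cons last_rcons.
- by rewrite size_rev size_belast.
Qed.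

Lemma laced_mirror S m x z : laced lt f S m x z -> laced lt' f' S m z x.
Proof.
case=> /cup_between_mirror h [i [j [/cup_to_mirror hi /cup_from_mirror hj ij]]].
by split=> //; exists j, i; rewrite addnC.
Qed.

Lemma interweaved_mirror S m : interweaved lt f S m -> interweaved lt' f' S m.
Proof.
case=> x [x' [z [z' [xx' x'z zz' /laced_mirror h /laced_mirror h']]]].
by exists z', z, x', x.
Qed.

Lemma hinged_mirror S m : hinged lt f S m -> hinged lt' f' S m.
Proof. by case=> o [/cup_to_mirror h /cup_from_mirror h']; exists o. Qed.

Lemma cups_bounded_mirror S m : cups_bounded lt f S m -> cups_bounded lt' f' S m.
Proof.
move=> bd s; rewrite -[s]revK cup_mirror size_rev => /bd.
by rewrite size_rev.
Qed.

End Mirror.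

(** * Ranks and records *)

Section Ranks.
Variables (T : finType) (lt : rel T) (f : T -> T -> T -> bool).
Implicit Types (S : {set T}).
Hypothesis cap4 : no_4cap lt f.

Let irr : irreflexive lt. Proof. by case: cap4. Qed.
Let tr : transitive lt. Proof. by case: cap4. Qed.
Let tot x y : x != y -> lt x y || lt y x. Proof. by case: cap4 => _ _ h _; apply: h. Qed.

Notation cup := (cup lt f).
Notation cup_to := (cup_to lt f).
Notation cup_from := (cup_from lt f).
Notation cup_between := (cup_between lt f).
Notation laced := (laced lt f).
Notation hinged := (hinged lt f).
Notation interweaved := (interweaved lt f).
Notation cups_bounded := (cups_bounded lt f).
Notation rank := (rank lt f).
Notation records := (records lt f).

Lemma cup_between_lt S k x z : cup_between S k x z -> x = z \/ lt x z.
Proof.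
case=> q [/and3P[/= hp _ _] <- _]; case: q hp => [|y q] hp; first by left.
right; move: hp; rewrite path_sortedE // => /andP[/allP h _].
by apply: h; rewrite /= mem_last.
Qed.

Lemma cup_between_append S k x b c : cup_between S k x b -> c \in S -> lt b c ->
  never_cap_end lt f S b c -> cup_between S k.+1 x c.
Proof.
case=> q [hq hb <-] cS bc hR; exists (rcons q c).
split; rewrite ?size_rcons ?last_rcons // -rcons_cons.
by move: hq; rewrite lastI hb => hq; apply: cup_append.
Qed.

(* The first point whose rank is at least [k] has rank exactly [k], since its
   predecessor on a longest cup would otherwise come earlier. *)
Lemma first_of_rank S k v : v \in S -> 0 < k <= rank S v ->
  exists d, [/\ d \in S, d = v \/ lt d v, rank S d = k
             & forall u, u \in S -> lt u d -> rank S u < k].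
Proof.
move=> vS /andP[k0 kv].
pose P d := [&& d \in S, k <= rank S d & (d == v) || lt d v].
have Pv : P v by rewrite /P vS kv eqxx.
(* Minimising the number of predecessors selects a point before which [P] fails. *)
case: (@arg_minnP _ v P (fun d => #|[set y | lt y d]|) Pv) => d /and3P[dS kd dv] dmin.
have hmin u : u \in S -> lt u d -> rank S u < k.
  move=> uS ud; rewrite ltnNge; apply/negP => ku.
  have /dmin : P u.
    by rewrite /P uS ku /=; case/orP: dv => [/eqP <-|/(tr ud) ->]; rewrite ?ud orbT.
  rewrite leqNgt => /negP[]; apply: proper_card; apply/properP; split.
    by apply/subsetP => y; rewrite !inE => /tr; apply.
  by exists u; rewrite !inE ?irr.
exists d; split=> //; first by case/orP: dv => [/eqP|]; [left|right].
apply/eqP; rewrite eqn_leq kd andbT leqNgt; apply/negP => dk.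
case: (rank_cup_to cap4 (ltn_trans k0 dk) (leqnn _)) => p.
case/lastP: p => [|p a] hp; first by move=> /= h; lia.
rewrite size_rcons => hs.
have aS : a \in S by apply: (cup_in hp); rewrite mem_rcons inE mem_rcons mem_head orbT.
have ad : lt a d.
  by move: hp; rewrite -!cats1 -!catA => /cup_catr; rewrite cup2 => /and3P[].
have : cup_to S (rank S d).-1 a.
  by exists p; [move: hp; rewrite -[rcons (rcons p a) d]cats1 => /cup_catl | lia].
by move=> /(cup_to_rank cap4); have := hmin a aS ad; lia.
Qed.

(** The rank is injective on records, since the later of two has the larger rank, and it takes
    values from 1 to [m.-1] there. *)
Lemma card_records S m : #|records S m| <= m.-1.
Proof.
rewrite cardE -(size_map (rank S)) -(size_iota 1 m.-1); apply: uniq_leq_size.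
  rewrite map_inj_in_uniq ?enum_uniq // => u v; rewrite !mem_enum !inE.
  move=> /and3P[uS _ /forall_inP hu] /and3P[vS _ /forall_inP hv] e.
  apply/eqP; apply: contraT => /tot /orP[uv|vu].
    by move: (hv u uS); rewrite uv e ltnn.
  by move: (hu v vS); rewrite vu e ltnn.
move=> k /mapP[d]; rewrite mem_enum !inE mem_iota => /and3P[dS dm _] ->.
by have := rank_gt0 cap4 dS; lia.
Qed.

Lemma not_record S m v : v \in S :\: records S m ->
  m <= rank S v \/ exists u, [/\ u \in S, lt u v & rank S v <= rank S u].
Proof.
rewrite !inE => /andP[+ vS]; rewrite vS /=; case: ltnP => [_ /=|]; last by left.
case/forall_inPn => u uS; rewrite negb_imply -leqNgt => /andP[uv r].
by right; exists u.
Qed.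

Lemma card_setD_records S m : #|S| <= #|S :\: records S m| + m.-1.
Proof.
rewrite -(cardsID (records S m) S) addnC leq_add2l.
exact: leq_trans (subset_leq_card (subsetIr _ _)) (card_records S m).
Qed.

(** * Deleting the records *)

Section Shrink.
Variables (S : {set T}) (m : nat).
Hypotheses (bd : cups_bounded S m.+1) (nh : ~ hinged S m.+1).
Let S' := S :\: records S m.+1.

Let sub : S' \subset S. Proof. exact: subsetDl. Qed.

(** An [m.+1]-cup in [S'] either starts at a hinged point or is lengthened beyond the bound by an
    earlier point of [S]. *)
Lemma cups_bounded_shrink : cups_bounded S' m.
Proof.
move=> [//|y q] hs; rewrite leqNgt; apply/negP => ms.
have yS' : y \in S' by apply: (cup_in hs); rewrite mem_head.
have yS := subsetP sub _ yS'; have {}hs := cup_sub sub hs.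
case: (not_record yS') => [ry|[u [uS uy ru]]].
  apply: nh; exists y; split; first exact: rank_cup_to ry.
  by exists q => //; move: (bd hs) ms => /=; lia.
have hL := rank_le_never_cap_start cap4 uS yS uy ru.
by move: (bd (cup_prepend hs uS uy hL)) ms => /=; lia.
Qed.

(** The cup is lengthened at its first point [y], unless [y] has rank at least [m.+1]. In that case
    [y] is [w], since otherwise [y] put before the [m]-cup starting at [w] would be hinged. *)
Lemma cup_to_shrink i w : cup_to S' i w -> cup_from S' m w ->
  cup_to S i.+1 w \/ cup_to S m.+1 w.
Proof.
move=> hi hm; have [y hy] := cup_to_between hi.
have yS' := cup_from_in (cup_between_from hy).
have yS := subsetP sub _ yS'.
have wS := subsetP sub _ (cup_to_in hi).
have {}hy : cup_between S i y w by case: hy => q [/(cup_sub sub) hq h1 h2]; exists q.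
case: (not_record yS') => [ry|[u [uS uy ru]]]; last first.
  left; apply: cup_between_to (cup_between_prepend hy uS uy _).
  exact: rank_le_never_cap_start ru.
right; have ty := rank_cup_to cap4 (ltn0Sn m) ry.
case: (cup_between_lt hy) => [<- //|yw]; case: nh; exists y; split=> //.
apply: (cup_from_prepend (cup_from_sub sub hm) yS yw).
exact (end_never_cap_start cap4 bd ty wS yw).
Qed.

(** Outside the exceptional case, [d] is the first point with the rank of [x]. The edge from [d] to
    [x] lengthens the [m]-cup, and by equality of ranks an [i.+1]-cup ends at [d] as it does at
    [x]. *)
Lemma laced_shrink x z : laced S' m x z ->
  (cup_to S m.+1 x /\ cup_from S m x) \/
  exists d, [/\ lt d x, rank S d = rank S x,
    forall u, u \in S -> lt u d -> rank S u < rank S x & laced S m.+1 d z].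
Proof.
case=> hxz [i [j [hi hj ij]]]; have hm := cup_between_from hxz.
have hmS := cup_from_sub sub hm.
have xS' := cup_from_in hm; have xS := subsetP sub _ xS'.
case: (cup_to_shrink hi hm) => [hi1|]; last by left.
case: (not_record xS') => [rx|[u [uS ux ru]]].
  by left; split=> //; apply: rank_cup_to rx.
have x0 := rank_gt0 cap4 xS.
have [|d [dS du rd hd]] := @first_of_rank S (rank S x) u uS; first by rewrite x0 ru.
have dx : lt d x by case: du => [->|/tr]; last apply.
right; exists d; split=> //; split.
  case: hxz => q [/(cup_sub sub) hq h1 h2].
  apply: (@cup_between_prepend _ _ _ _ _ d x) => //; first by exists q.
  by apply: rank_le_never_cap_start; rewrite ?rd.
exists i.+1, j; split; last by rewrite addSn.
  by apply: rank_cup_to => //; rewrite rd; apply: cup_to_rank.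
exact: cup_from_sub hj.
Qed.

(** The ends stay, and the starts move back to the first points [d], [d'] of their ranks; these are
    in order because [x] has smaller rank than [x']. *)
Lemma interweaved_shrink : interweaved S' m ->
  interweaved S m.+1 \/ exists o, cup_to S m.+1 o /\ cup_from S m o.
Proof.
case=> x [x' [z [z' [xx' x'z zz' hx hx']]]].
case: (laced_shrink hx) => [h|[d [dx rd dmin hd]]]; first by right; exists x.
case: (laced_shrink hx') => [h|[d' [dx' rd' _ hd']]]; first by right; exists x'.
left; exists d, d', z, z'; split=> //; last exact: tr x'z.
case: hx => hxz _; case: hx' => hxz' _.
have xS' := cup_from_in (cup_between_from hxz); have xS := subsetP sub _ xS'.
have x'S := subsetP sub _ (cup_from_in (cup_between_from hxz')).
(* Otherwise [x] would extend the [m]-cup starting at [x'] to an [m.+1]-cup inside [S']. *)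
have rlt : rank S x < rank S x'.
  rewrite ltnNge; apply/negP => /(rank_le_never_cap_start cap4 xS x'S xx') hL.
  have := cup_from_bounded cups_bounded_shrink
    (cup_from_prepend (cup_between_from hxz') xS' xx' _).
  rewrite ltnn => h; apply: notF; apply: h => e eS'; apply: hL.
  exact: (subsetP sub).
have dd' : d != d' by apply/eqP => e; move: rd rd'; rewrite e; lia.
case/orP: (tot dd') => // d'd.
have d'S := cup_from_in (cup_between_from (proj1 hd')).
by have := dmin d' d'S d'd; rewrite rd' ltnNge (ltnW rlt).
Qed.

End Shrink.

(** * Laced cups and the exceptional points *)

Lemma hinged_laced S m : hinged S m -> exists x z, laced S m x z.
Proof.
case=> o [ho /[dup] ho' /cup_from_between[z hz]]; exists o, z; split=> //.
exists m, 1; split=> //; last by rewrite addn1.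
exact: cup_from1 (cup_to_in (cup_between_to hz)).
Qed.

Lemma laced_exists m S : 0 < m -> cups_bounded S m -> 'C(m, 2) < #|S| ->
  exists x z, laced S m x z.
Proof.
elim: m S => [//|[|m] IH] S _ bd hS.
  case/card_gt0P: hS => x xS; exists x, x; split; first by exists [::]; rewrite cup1.
  by exists 1, 1; split; [apply: cup_to1 | apply: cup_from1 |].
case: (classic (hinged S m.+2)) => [/hinged_laced //|nh].
have := card_setD_records S m.+2; rewrite binS bin1 in hS => hS'.
have [||x [z hxz]] := IH (S :\: records S m.+2) isT; first exact: cups_bounded_shrink.
  by move: hS hS' => /=; lia.
(* In the exceptional case the [m.+2]-cup ending at [x] is itself laced, by its first point alone
   and the [m.+1]-cup starting at [x]. *)
case: (laced_shrink bd nh hxz) => [[hx hx']|[d [_ _ _ hd]]]; last by exists d, z.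
have [x0 h0] := cup_to_between hx; exists x0, x; split=> //.
exists 1, m.+1; split=> //.
exact: cup_to1 (cup_from_in (cup_between_from h0)).
Qed.

(** Take an [m.+1]-cup ending at [o]. If it starts after [o'], its first point is hinged; if it
    starts at [o'], it is rerouted through the predecessor [w] of [o'] on the [m]-cup ending at
    [o']. *)
Lemma end_reached_from_before S m o o' : 1 < m ->
  cups_bounded S m.+1 -> ~ hinged S m.+1 ->
  cup_to S m.+1 o -> cup_from S m o -> cup_from S m.+1 o' -> cup_to S m o' ->
  lt o' o /\ exists2 x, lt x o' & cup_between S m.+1 x o.
Proof.
move=> m1 bd nh ho ho1 ho' ho1'.
have oS := cup_to_in ho; have o'S := cup_to_in ho1'.
have neq : o' != o by apply/eqP => e; apply: nh; exists o; rewrite -{2}e.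
have o'o : lt o' o.
  have := tot neq; rewrite orbC.
  by have /negPf -> := end_not_before_start cap4 bd ho ho'.
split=> //; have [x0 hx0] := cup_to_between ho.
have x0S := cup_from_in (cup_between_from hx0).
have [e|ne] := eqVneq x0 o'; last first.
  case/orP: (tot ne) => [x0o'|o'x0]; first by exists x0.
  have hR := start_never_cap_end cap4 bd (cup_between_from hx0) o'S o'x0.
  case: nh; exists x0; split; last exact: cup_between_from hx0.
  exact: (cup_to_append ho1' x0S o'x0 hR).
move: hx0; rewrite {x0 x0S}e.
case=> [[|y [|y' q]]] [hq hl hs]; try by move: hs => /=; lia.
case: ho1' => p; case/lastP: p => [|p w] hp hps; first by move: hps => /=; lia.
case: ho1 => [[|s r]] hr hrs; first by move: hrs => /=; lia.
rewrite size_rcons in hps.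
have {}hp : cup S (p ++ [:: w; o']) by move: hp; rewrite -!cats1 -catA.
have := cup_catr hp; rewrite cup2 => /and3P[wo' wS _].
have := @cup_catl _ _ _ S [:: o'; y] _ hq; rewrite cup2 => /and3P[o'y _ yS].
have wy := tr wo' o'y.
have yo : lt y o.
  case: (@cup_between_lt S (size q).+2 y o) => //.
    by exists (y' :: q); split=> //; apply: (@cup_catr _ _ _ S [:: o']).
  move=> e; have := cup_uniq cap4 hq; rewrite /= => /and3P[_ /negP[]].
  by rewrite e -hl /= mem_last.
have := @cup_catl _ _ _ S [:: o; s] _ hr; rewrite cup2 => /and3P[os _ sS].
(* Both triples are caps, since otherwise cups could be glued into one that is
   too long; hence [w], [y] and [o] always continue to an m.+1-cup ending at [o]. *)
have n1 : ~~ f w o' y.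
  apply/negP => h; have : cup S (p ++ w :: o' :: y :: y' :: q).
    rewrite cup_glue hp (cup_glue _ _ _ [:: w]) hq cup3.
    by rewrite wo' o'y h wS o'S yS.
  move/bd; rewrite size_cat; move: hs hps m1 => /=; clear=> hs hps m1; lia.
have f1 : f o' y o.
  by case: cap4 => _ _ _ /(_ w o' y o wo' o'y yo); rewrite (negPf n1).
have n2 : ~~ f y o s.
  apply/negP => h; have : cup S (o' :: y :: o :: s :: r).
    rewrite (cup_glue _ _ _ [:: o']) (cup_glue _ _ _ [:: y]) hr !cup3.
    by rewrite o'y yo os f1 h o'S yS oS sS.
  move/bd; move: hrs => /=; clear=> hrs; lia.
have hRyo : never_cap_end lt f S y o.
  move=> a _ ay; case: cap4 => _ _ _ /(_ a y o s ay yo os).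
  by rewrite (negPf n2) orbF.
(* Either the [m.-1]-cup ending at [w] continues to [y] and [o], or [w] replaces [o'] in front of
   [y]. *)
case: (never_cap_dichotomy cap4 S wy) => [hR|hL]; last first.
  exists w => //; exists (y :: y' :: q); split=> //.
  by apply: cup_prepend => //; apply: (@cup_catr _ _ _ S [:: o']).
have [x hx] : exists x, cup_between S (size p).+1 x w.
  apply: cup_to_between; exists p => //.
  by move: hp; rewrite -[[:: w; o']]/([:: w] ++ [:: o']) catA => /cup_catl; rewrite cats1.
exists x; first by case: (cup_between_lt hx) => [->|/tr]; last apply.
rewrite -hps; apply: (cup_between_append _ oS yo hRyo).
exact: (cup_between_append hx yS wy hR).
Qed.

End Ranks.

(** * The induction on [m] *)

Lemma hinged2 (T : finType) (lt : rel T) (f : T -> T -> T -> bool) (S : {set T}) :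
  no_4cap lt f -> 2 < #|S| -> hinged lt f S 2.
Proof.
case=> _ _ tot _ /card_gt2P[x [y [z [[xS yS zS] [xy yz zx]]]]].
have mid a b c : a \in S -> b \in S -> c \in S -> lt a b -> lt b c ->
    hinged lt f S 2.
  move=> aS bS cS ab bc.
  by exists b; split; [exists [:: a] | exists [:: c]]; rewrite //= cup2 ?ab ?bc ?aS bS.
case/orP: (tot _ _ xy) => xy'; case/orP: (tot _ _ yz) => yz';
  case/orP: (tot _ _ zx) => zx';
  solve [exact: mid xy' yz' | exact: mid yz' zx' | exact: mid zx' xy'
       | exact: mid yz' xy' | exact: mid zx' yz' | exact: mid xy' zx'].
Qed.

Lemma hinged_or_interweaved m (T : finType) (lt : rel T)
    (f : T -> T -> T -> bool) (S : {set T}) :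
  no_4cap lt f -> 1 < m -> cups_bounded lt f S m -> 'C(m, 2).+1 < #|S| ->
  hinged lt f S m \/ interweaved lt f S m.
Proof.
elim: m T lt f S => [//|m IH] T lt f S cap4; rewrite ltnS leq_eqVlt.
case/predU1P => [<- bd|m1 bd hS]; first by left; apply: hinged2.
case: (classic (hinged lt f S m.+1)) => [|nh]; [by left|right].
(* Stated for any order, as it is applied to [lt] and to its reversal. *)
have half (lt1 : rel T) (f1 : T -> T -> T -> bool) :
    no_4cap lt1 f1 -> cups_bounded lt1 f1 S m.+1 -> ~ hinged lt1 f1 S m.+1 ->
    interweaved lt1 f1 S m.+1 \/
    exists o, cup_to lt1 f1 S m.+1 o /\ cup_from lt1 f1 S m o.
  move=> cap1 bd1 nh1; have hS' := card_setD_records cap1 S m.+1.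
  case: (IH T lt1 f1 (S :\: records lt1 f1 S m.+1)) => //.
  - exact: cups_bounded_shrink.
  (* The at most [m] deleted records are paid for by ['C(m.+1, 2) = 'C(m, 2) + m]. *)
  - by move: hS hS'; rewrite binS bin1 /=; lia.
  (* At size [m] both outcomes of [cup_to_shrink] give an [m.+1]-cup ending at [o]. *)
  - case=> o [h h']; right; exists o; split; last exact: cup_from_sub (subsetDl _ _) h'.
    by case: (cup_to_shrink cap1 bd1 nh1 h h').
  - exact: interweaved_shrink.
have cap4' := no_4cap_mirror cap4; have bd' := cups_bounded_mirror bd.
have nh' : ~ hinged (fun x y => lt y x) (fun x y z => f z y x) S m.+1.
  by move/hinged_mirror.
case: (half _ _ cap4 bd nh) => [//|[o [ho ho1]]].
case: (half _ _ cap4' bd' nh') => [/interweaved_mirror //|[o' [ho' ho1']]].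
have {}ho' : cup_from lt f S m.+1 o' by apply: cup_to_mirror ho'.
have {}ho1' : cup_to lt f S m o' by apply: cup_from_mirror ho1'.
have [o'o [x xo' hx]] := end_reached_from_before cap4 m1 bd nh ho ho1 ho' ho1'.
have [_ [z oz hz]] := end_reached_from_before cap4' m1 bd' nh'
  (cup_from_mirror ho') (cup_to_mirror ho1') (cup_to_mirror ho) (cup_from_mirror ho1).
have {}hz : cup_between lt f S m.+1 o' z by apply: cup_between_mirror hz.
(* The cup from [x] to [o] is laced by [x] alone and the [m]-cup starting at [o], the cup from [o']
   to [z] by the [m]-cup ending at [o'] and [z] alone. *)
exists x, o', o, z; split=> //; split=> //.
  by exists 1, m; split=> //; apply: cup_to1 (cup_from_in (cup_between_from hx)).
exists m, 1; split=> //; last by rewrite addn1.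
exact: cup_from1 (cup_to_in (cup_between_to hz)).
Qed.

(** * Joining laced cups in a configuration *)

Theorem theorem2p9 (n : nat) (f : config ('C(n.-1, 2) + 2)) :
  3 <= n -> has_cap f 4 \/ has_cup f n \/ has_gon f 3 n.-1.
Proof.
case: n f => [//|m] /=; set N := _ + 2 => f; rewrite ltnS => m1.
pose lt (x y : 'I_N) := x < y.
case: (classic (has_cap f 4)) => [|ncap]; [by left|right].
case: (classic (has_cup f m.+1)) => [|ncup]; [by left|right].
apply: NNPP => ngon.
have cap4 : no_4cap lt f.
  split=> [x|y x z|x y|a b c d ab bc cd]; first exact: ltnn.
  - exact: ltn_trans.
  - by rewrite -neq_ltn.
  rewrite -[_ || _]negbK negb_or; apply/negP => /andP[h1 h2]; apply: ncap.
  exists [:: a; b; c; d].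
  by rewrite /is_cap /= (ab : a < b) (bc : b < c) (cd : c < d) h1 h2.
have bd S : cups_bounded lt f S m.
  move=> s hs; rewrite leqNgt; apply/negP => ms; apply: ncup.
  exists (take m.+1 s); split; last by rewrite size_takel.
  have := hs; rewrite -{1}[s](cat_take_drop m.+1) => /cup_catl /and3P[h1 h2 _].
  exact/andP.
(* A cap on [x], [y], [z] would close the [m]-cup to a [(3, m)]-gon. *)
have nogon S x y z : cup_between lt f S m x z -> lt x y -> lt y z -> f x y z.
  case=> q [/and3P[h1 h2 _] hl hs] xy yz; apply: contraT => nf; case: ngon.
  exists [:: x; y; z], (x :: q); split; first split=> //.
  - by rewrite /is_cap /= (xy : x < y) (yz : y < z) nf.
  - exact/andP.
  by rewrite /= lastI rev_rcons hl.
have hT : 'C(m, 2).+1 < #|[set: 'I_N]| by rewrite cardsT card_ord /N addn2.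
case: (hinged_or_interweaved cap4 m1 (bd setT) hT) => [[o [ho ho']]|].
  (* Without [o] enough points remain for a laced cup, which then avoids [o]. *)
  have hTo : 'C(m, 2) < #|[set: 'I_N] :\ o|.
    by move: hT; rewrite (cardsD1 o) inE add1n ltnS.
  have [a [b [hab [i [j [ha hb ij]]]]]] := laced_exists cap4 (ltnW m1) (bd _) hTo.
  have sub : [set: 'I_N] :\ o \subset setT by apply: subsetT.
  have aS := cup_to_in ha; have bS := cup_from_in hb.
  have hbT := cup_to_sub sub (cup_between_to hab).
  have haT := cup_from_sub sub (cup_between_from hab).
  have ao : lt a o.
    case/setD1P: aS => ao _; have [_ _ tot _] := cap4.
    have := tot _ _ ao; rewrite orbC.
    by have /negPf -> := end_not_before_start cap4 (bd _) ho haT.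
  have ob : lt o b.
    case/setD1P: bS => bo _; have [_ _ tot _] := cap4.
    by have := tot _ _ bo; have /negPf -> := end_not_before_start cap4 (bd _) hbT ho'.
  have hR := start_never_cap_end cap4 (bd _) ho' (in_setT a) ao.
  have hL := end_never_cap_start cap4 (bd _) ho (in_setT b) ob.
  (* The lacing cups join through [o] into a cup of more than [m] points. *)
  have := cup_join_bounded (bd _) (cup_to_sub sub ha) (in_setT o)
    (cup_from_sub sub hb) ao ob hR (nogon _ _ _ _ hab ao ob) hL.
  by rewrite ltnNge ij.
case=> x [x' [z [z' [xx' x'z zz' hx hx']]]].
case: hx => hxz [i [j [hi hj ij]]]; case: hx' => hxz' [i' [j' [hi' hj' ij']]].
have hR := start_never_cap_end cap4 (bd _) (cup_between_from hxz') (in_setT x) xx'.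
have hL := end_never_cap_start cap4 (bd _) (cup_between_to hxz) (in_setT z') zz'.
have f1 := nogon _ _ _ _ hxz xx' x'z; have f2 := nogon _ _ _ _ hxz' x'z zz'.
(* If the edge ends no cap, the cups lacing the second pair join through [z]; if it starts none,
   those lacing the first join through [x']. *)
case: (never_cap_dichotomy cap4 setT x'z) => h.
  have := cup_join_bounded (bd _) hi' (in_setT z) hj' x'z zz' h f2 hL.
  by rewrite ltnNge ij'.
have := cup_join_bounded (bd _) hi (in_setT x') hj xx' x'z hR f1 h.
by rewrite ltnNge ij.
Qed.
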